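(* Let $D$ be an integral domain and let $*_1$ and $*_2$ be star operations of finite type on $D$ such that $*_1\leq *_2$. Then $D$ is a VFD if and only if $D$ is a $*_1$-VIFD and ${\rm Cl}_{*_2}(D)=\{0\}$. In particular, $D$ is a VFD if and only if $D$ is a VIFD and ${\rm Pic}(D)=\{0\}$.
   Context: Let $D$ be an integral domain with quotient field $K$. An overring of $D$ is a subring of $K$ containing $D$. $F(D)$ (resp. $f(D)$) is the set of nonzero fractional (resp. nonzero finitely generated fractional) ideals of $D$; for $A\in F(D)$, $A^{-1}=\{x\in K\mid xA\subseteq D\}$. A star operation on $D$ is a map $*:F(D)\to F(D)$, $A\mapsto A_*$, such that for all $A,B\in F(D)$ and nonzero $c\in K$: $A\subseteq A_*=(A_* )_*$; $A\subseteq B$ implies $A_*\subseteq B_*$; $(cA)_*=cA_*$; $D_*=D$. It is of finite type if $A_*=\bigcup_{C\in f(D),\,C\subseteq A}C_*$ for all $A\in F(D)$. Write $*_1\leq *_2$ if $I_{*_1}\subseteq I_{*_2}$ for all $I\in F(D)$. The $d$-operation is $A_d=A$. A fractional $*$-ideal is an $I\in F(D)$ with $I_*=I$. $I\in F(D)$ is $*$-invertible if $(II^{-1})_*=D$. The $*$-invertible fractional $*$-ideals form an abelian group $T_*(D)$ under $(I,J)\mapsto(IJ)_*$, and ${\rm Cl}_*(D)$ is the quotient of $T_*(D)$ by the subgroup of nonzero principal fractional ideals. ${\rm Pic}(D)$ is the group of invertible fractional ideals modulo the nonzero principal fractional ideals. An ideal $I$ of $D$ is a valuation ideal if there is a valuation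 overring $V$ of $D$ with $IV\cap D=I$ ($D$ itself is allowed). A valuation element of $D$ is a nonzero nonunit $a\in D$ such that $aD$ is a valuation ideal. $D$ is a VFD (valuation factorization domain) if every nonzero nonunit of $D$ is a finite product of valuation elements. $D$ is a $*$-VIFD ($*$-valuation ideal factorization domain) if each nonzero principal ideal $I$ of $D$ can be written as $I=(\prod_{i=1}^n I_i)_*$ with $n\in\mathbb{N}$ and valuation ideals $I_i$ of $D$. A VIFD is a $d$-VIFD. *)

(* Defs.v *)
From mathcomp Require Import all_boot all_algebra.
From mathcomp Require Import classical_sets.

Set Implicit Arguments.
Unset Strict Implicit.
Unset Printing Implicit Defensive.

Import GRing.Theory.
Local Open Scope ring_scope.
Local Open Scope classical_set_scope.

Definition emb (D : idomainType) : D -> {fraction D} := @FracField.tofrac D.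

(* The image of D in its quotient field: all ideals, overrings, etc. of D are
   subsets of {fraction D}. *)
Definition base (D : idomainType) : set {fraction D} := range (@emb D).
Arguments base D : clear implicits.

Definition submodule (D : idomainType) (A : set {fraction D}) : Prop :=
  [/\ A 0,
      forall x y, A x -> A y -> A (x + y)
    & forall (d : D) x, A x -> A (emb d * x)].

(* F(D) *)
Definition frac_ideal (D : idomainType) (A : set {fraction D}) : Prop :=
  [/\ submodule A,
      exists2 d : D, d != 0 & forall x, A x -> base D (emb d * x)
    & exists2 x, A x & x != 0].

Definition dspan (D : idomainType) (n : nat) (g : 'I_n -> {fraction D}) :
    set {fraction D} :=
  [set \sum_(i < n) emb (c i) * g i | c in [set: 'I_n -> D]].

(* f(D) *)
Definition fg_frac_ideal (D : idomainType) (A : set {fraction D}) : Prop :=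
  frac_ideal A /\ exists (n : nat) (g : 'I_n -> {fraction D}), A = dspan g.

(* AB: finite sums of products ab with a in A and b in B *)
Definition idmul (D : idomainType) (A B : set {fraction D}) :
    set {fraction D} :=
  [set x | exists (n : nat) (a b : 'I_n -> {fraction D}),
     [/\ forall i, A (a i), forall i, B (b i) & x = \sum_(i < n) a i * b i]].

Definition idinv (D : idomainType) (A : set {fraction D}) :
    set {fraction D} :=
  [set x | forall a, A a -> base D (x * a)].

Definition scale (D : idomainType) (c : {fraction D}) (A : set {fraction D}) :
    set {fraction D} :=
  [set c * x | x in A].

Definition principal (D : idomainType) (c : {fraction D}) :
    set {fraction D} := scale c (base D).

(* The axioms constrain s on F(D) only; its values elsewhere are irrelevant. *)
Definition star_operation (D : idomainType)
    (s : set {fraction D} -> set {fraction D}) : Prop :=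
  [/\ forall A, frac_ideal A -> frac_ideal (s A),
      forall A, frac_ideal A -> A `<=` s A /\ s (s A) = s A,
      forall A B, frac_ideal A -> frac_ideal B -> A `<=` B -> s A `<=` s B,
      forall (c : {fraction D}) A, c != 0 -> frac_ideal A ->
        s (scale c A) = scale c (s A)
    & s (base D) = base D].

Definition finite_type (D : idomainType)
    (s : set {fraction D} -> set {fraction D}) : Prop :=
  forall A, frac_ideal A ->
    s A = \bigcup_(C in [set C | fg_frac_ideal C /\ C `<=` A]) s C.

Definition star_le (D : idomainType)
    (s1 s2 : set {fraction D} -> set {fraction D}) : Prop :=
  forall A, frac_ideal A -> s1 A `<=` s2 A.

Definition d_operation (D : idomainType) (A : set {fraction D}) :
    set {fraction D} := A.

Definition overring (D : idomainType) (V : set {fraction D}) : Prop :=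
  subring_closed [in V] /\ base D `<=` V.

Definition valuation_overring (D : idomainType) (V : set {fraction D}) : Prop :=
  overring V /\ forall x : {fraction D}, x != 0 -> V x \/ V x^-1.

Definition ideal (D : idomainType) (I : set {fraction D}) : Prop :=
  submodule I /\ I `<=` base D.

Definition valuation_ideal (D : idomainType) (I : set {fraction D}) : Prop :=
  ideal I /\
  exists2 V : set {fraction D}, valuation_overring V & idmul I V `&` base D = I.

Definition valuation_element (D : idomainType) (a : D) : Prop :=
  [/\ a != 0, a \isn't a GRing.unit & valuation_ideal (principal (emb a))].

Definition VFD (D : idomainType) : Prop :=
  forall a : D, a != 0 -> a \isn't a GRing.unit ->
    exists (n : nat) (b : 'I_n -> D),
      (forall i, valuation_element (b i)) /\ a = \prod_(i < n) b i.

Definition idprod (D : idomainType) (n : nat) (I : 'I_n -> set {fraction D}) :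
    set {fraction D} :=
  \big[@idmul D / base D]_(i < n) I i.

(* The factors are required to be nonzero because s is meaningful on F(D)
   only. *)
Definition star_VIFD (D : idomainType)
    (s : set {fraction D} -> set {fraction D}) : Prop :=
  forall a : D, a != 0 ->
    exists (n : nat) (I : 'I_n -> set {fraction D}),
      [/\ (0 < n)%N,
          forall i, valuation_ideal (I i) /\ I i <> [set 0]
        & principal (emb a) = s (idprod I)].

Definition VIFD (D : idomainType) : Prop := star_VIFD (@d_operation D).

(* The subgroup of nonzero principal fractional ideals *)
Definition principals (D : idomainType) : set (set {fraction D}) :=
  [set principal c | c in [set c | c != 0]].
Arguments principals D : clear implicits.

(* T_s(D), a group under star_mul s *)
Definition star_inv_ideals (D : idomainType)
    (s : set {fraction D} -> set {fraction D}) : set (set {fraction D}) :=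
  [set I | [/\ frac_ideal I, s I = I & s (idmul I (idinv I)) = base D]].

Definition star_mul (D : idomainType)
    (s : set {fraction D} -> set {fraction D}) (I J : set {fraction D}) :
    set {fraction D} := s (idmul I J).

Definition inv_ideals (D : idomainType) : set (set {fraction D}) :=
  [set I | frac_ideal I /\ idmul I (idinv I) = base D].
Arguments inv_ideals D : clear implicits.

Definition op_coset (T : Type) (op : T -> T -> T) (H : set T) (x : T) : set T :=
  [set op x h | h in H].

(* The quotient of the abelian group (G, op) by its subgroup H, as the set of
   cosets of H; its zero element is H. *)
Definition coset_space (T : Type) (op : T -> T -> T) (G H : set T) :
    set (set T) :=
  [set op_coset op H x | x in G].

Definition Cl (D : idomainType)
    (s : set {fraction D} -> set {fraction D}) : set (set (set {fraction D})) :=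
  coset_space (star_mul s) (star_inv_ideals s) (principals D).

Definition Pic (D : idomainType) : set (set (set {fraction D})) :=
  coset_space (@idmul D) (inv_ideals D) (principals D).
Arguments Pic D : clear implicits.

(* Main.v *)
Require Import Defs.
From HB Require Import structures.
From mathcomp Require Import all_boot all_algebra.
From mathcomp Require Import boolp classical_sets.

Set Implicit Arguments.
Unset Strict Implicit.
Unset Printing Implicit Defensive.

Import GRing.Theory.
Local Open Scope ring_scope.
Local Open Scope classical_set_scope.

(** Call a nonzero element [a] valuative if [a V] meets [D] in [a D] for some
valuation overring [V]; these are the units and the valuation elements.

Sufficiency.  Let [a D = s1 (I_1 ... I_n)] with valuation ideals [I_i].  Then
also [a D = s2 (I_1 ... I_n)], so each [s2 I_i] is [s2]-invertible and hence,
the class group being trivial, equal to [b_i D] for some [b_i].  It follows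
that [a] is a unit times the product of the [b_i]
([star_idprod_principal]).  Moreover [b_i] is valuative for the same [V] as
[I_i]: if [d] lies in [b_i V] and in [D], then
[(d / b_i) I_i <= I_i V `&` D = I_i <= b_i D], and applying [s2] gives
[(d / b_i) b_i D <= b_i D], that is, [b_i] divides [d]
([valuation_ideal_star_principal]).

Necessity.  A factorization into valuation elements is a factorization into
principal valuation ideals, so the point is that the class group vanishes.
This holds because a valuation factorization domain is pre-Schreier, meaning
that every nonzero element is primal ([VFD_primal]).  For a fixed valuation
ring the valuative elements are closed under powers and divisors, and the
divisors of one of them form a chain.  If a valuative [a] divides a product of
valuative elements, then it divides a power of the factor [x] of largest
value; both [a] and [x] divide that power, so they are comparable
([valuative_dvd_prod]), and cancelling one against the other gives an
induction ([valuative_primal_prod]).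

In a pre-Schreier domain the divisibility order on the quotient field has the
Riesz interpolation property ([interpolation]).  Let [I] be an [s2]-invertible
[s2]-ideal.  As [s2] has finite type, there are finitely many [x_i] in [I] and
[y_j] in the inverse of [I] such that the ideal generated by suitable
combinations of the [x_i y_j] has closure containing [1].  All [x_i y_j] are
in [D], so some [c] satisfies [x_i / c, c y_j \in D], and closing up gives
[I = c D] ([star_invertible_principal]).

The statement on the Picard group is the case where both star operations are
the identity. *)

(** * Elements of the quotient field *)

HB.instance Definition _ (D : idomainType) :=
  GRing.RMorphism.copy (@emb D) (@FracField.tofrac D).

Lemma emb_eq0 (D : idomainType) (a : D) : (emb a == 0) = (a == 0).
Proof. exact: tofrac_eq0. Qed.

Lemma emb_inj (D : idomainType) : injective (@emb D).
Proof. by move=> x y /eqP; rewrite /emb tofrac_eq => /eqP. Qed.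

(** Used to bound the denominators of principal fractional ideals. *)
Lemma denominator_exists (D : idomainType) (c : {fraction D}) :
  exists2 d : D, d != 0 & base D (emb d * c).
Proof.
elim/quotW: c => x; exists \d_x; first exact: denom_ratioP.
exists \n_x => //; rewrite /emb; unlock FracField.tofrac.
rewrite -[RHS]FracField.pi_mul; apply/eqmodP; rewrite /= FracField.equivfE.
rewrite /FracField.mulf !numden_Ratio ?oner_neq0 ?mul1r ?denom_ratioP //.
by rewrite mulrC.
Qed.

Lemma base_emb (D : idomainType) (d : D) : base D (emb d).
Proof. by exists d. Qed.

Lemma base1 (D : idomainType) : base D 1.
Proof. by exists 1 => //; rewrite rmorph1. Qed.

Lemma baseM (D : idomainType) (x y : {fraction D}) :
  base D x -> base D y -> base D (x * y).
Proof. by move=> [a _ <-] [b _ <-]; exists (a * b) => //; rewrite rmorphM. Qed.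

Lemma principalP (D : idomainType) (c x : {fraction D}) :
  c != 0 -> principal c x <-> base D (x / c).
Proof.
move=> c0; split; first by case=> y Dy <-; rewrite mulrC mulKf.
by move=> Dx; exists (x / c) => //; rewrite mulrCA divff ?mulr1.
Qed.

(** * Valuation elements under divisibility *)

Definition divides (D : idomainType) (x y : D) : Prop := exists z, y = x * z.

Definition splits (D : idomainType) (p q r : D) : Prop :=
  exists u v, [/\ p = u * v, divides u q & divides v r].

Definition primal (D : idomainType) (p : D) : Prop :=
  forall q r, divides p (q * r) -> splits p q r.

(** The condition [a V `&` D = a D], read off elementwise. *)
Definition valuative (D : idomainType) (V : set {fraction D}) (a : D) : Prop :=
  a != 0 /\ forall d : D, V (emb d / emb a) -> divides a d.

Lemma valuation_overringM (D : idomainType) (V : set {fraction D}) x y :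
  valuation_overring V -> V x -> V y -> V (x * y).
Proof.
move=> [[[_ _ VM] _] _] Vx Vy.
by have := VM x y; rewrite !in_setE; apply.
Qed.

Lemma valuation_overringX (D : idomainType) (V : set {fraction D}) x n :
  valuation_overring V -> V x -> V (x ^+ n).
Proof.
move=> vV Vx; elim: n => [|n IHn]; last by rewrite exprS; apply: valuation_overringM.
by case: vV => -[_ DV] _; apply: DV; rewrite expr0; apply: base1.
Qed.

Lemma valuation_overring_emb (D : idomainType) (V : set {fraction D}) (d : D) :
  valuation_overring V -> V (emb d).
Proof. by case=> -[_ DV] _; apply: DV; apply: base_emb. Qed.

Lemma valuation_overring_total (D : idomainType) (V : set {fraction D})
    (x y : {fraction D}) :
  valuation_overring V -> x != 0 -> y != 0 -> V (x / y) \/ V (y / x).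
Proof.
move=> [_ tV] x0 y0; have /tV : x / y != 0 by rewrite mulf_neq0 ?invr_eq0.
by rewrite invfM invrK [x^-1 * y]mulrC.
Qed.

(** If [x V] contains [d], then [x y V] contains [d y]. *)
Lemma valuative_dvd (D : idomainType) (V : set {fraction D}) (x y : D) :
  valuative V (x * y) -> valuative V x.
Proof.
rewrite /valuative mulf_eq0 negb_or => -[/andP[x0 y0] xyP]; split=> // d Vd.
have [|z dyE] := xyP (d * y).
  rewrite !rmorphM invfM mulrACA divff ?mulr1 //.
  by rewrite emb_eq0.
by exists z; apply: (mulIf y0); rewrite dyE mulrAC.
Qed.

(** Divisibility by [a ^+ n.+1] can be tested one factor at a time: first cancel
[a ^+ n], then compare the cofactor with [a]. *)
Lemma valuativeX (D : idomainType) (V : set {fraction D}) (a : D) n :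
  valuation_overring V -> valuative V a -> valuative V (a ^+ n).
Proof.
move=> vV [a0 aP]; elim: n => [|n [an0 IHn]].
  by split=> [|d _]; [rewrite expr0 oner_neq0 | exists d; rewrite mul1r].
have ea0 : emb a != 0 by rewrite emb_eq0.
have ean0 : emb (a ^+ n) != 0 by rewrite emb_eq0.
split=> [|d Vd]; first by rewrite expf_neq0.
have [|z dE] := IHn d.
  have -> : emb d / emb (a ^+ n) = emb d / emb (a ^+ n.+1) * emb a.
    by rewrite exprSr (rmorphM (@emb D)) invfM mulrA divfK.
  by apply: valuation_overringM => //; apply: valuation_overring_emb.
subst d; have [|t zE] := aP z.
  have -> : emb z / emb a = emb (a ^+ n * z) / emb (a ^+ n.+1).
    by rewrite exprS !(rmorphM (@emb D)) [_ * emb z]mulrC -mulf_div divff ?mulr1.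
  exact: Vd.
by exists t; rewrite zE exprSr mulrA.
Qed.

(** Divisors of [a] are valuative for the same [V], so divisibility among them is
comparison of values, and values are totally ordered. *)
Lemma valuative_divisors_chain (D : idomainType) (V : set {fraction D})
    (a x y : D) :
  valuation_overring V -> valuative V a -> divides x a -> divides y a ->
  divides x y \/ divides y x.
Proof.
move=> vV va [x' ax] [y' ay].
have [x0 xP] : valuative V x by apply: (valuative_dvd (y := x')); rewrite -ax.
have [y0 yP] : valuative V y by apply: (valuative_dvd (y := y')); rewrite -ay.
have [] := @valuation_overring_total _ V (emb x) (emb y) vV.
- by rewrite emb_eq0.
- by rewrite emb_eq0.
- by move/yP; right.
- by move/xP; left.
Qed.

(** Both elements divide the power of [b], which is itself valuative. *)
Lemma valuative_dvdX_comparable (D : idomainType) (W : set {fraction D})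
    (a b : D) n :
  valuation_overring W -> valuative W b -> divides a (b ^+ n.+1) ->
  divides a b \/ divides b a.
Proof.
move=> vW wb ab; apply: (valuative_divisors_chain vW (valuativeX n.+1 vW wb)) => //.
by exists (b ^+ n); rewrite exprS.
Qed.

(** The factor [x] is one of largest value: the value of a product is at most the
value of the corresponding power of [x].  The list is kept nonempty by
singling out its head [x0]. *)
Lemma valuation_overring_max_power (D : idomainType) (V : set {fraction D})
    (x0 : D) (s : seq D) :
  valuation_overring V -> {in x0 :: s, forall x, x != 0} ->
  exists2 x, x \in x0 :: s &
    V (emb (x ^+ (size s).+1) / emb (\prod_(y <- x0 :: s) y)).
Proof.
move=> vV; elim: s => [|y s IHs] s0.
  exists x0; first by rewrite inE.
  rewrite big_seq1 expr1 divff ?emb_eq0 ?s0 ?inE //.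
  by rewrite -[1](rmorph1 (@emb D)); apply: valuation_overring_emb.
have [|x xs Vx] := IHs.
  by move=> z; rewrite inE => /orP[]zs; apply: s0; rewrite !inE zs ?orbT.
have y0 : emb y != 0 by rewrite emb_eq0 s0 // !inE eqxx orbT.
have x0' : emb x != 0.
  by rewrite emb_eq0 s0 //; move: xs; rewrite !inE => /orP[]->; rewrite ?orbT.
have -> : \prod_(z <- [:: x0, y & s]) z = y * \prod_(z <- x0 :: s) z.
  by rewrite !big_cons mulrCA.
move: (\prod_(z <- x0 :: s) z) Vx => p Vx.
have [Vxy|Vyx] := valuation_overring_total vV x0' y0.
  exists x; first by move: xs; rewrite !inE => /orP[]->; rewrite ?orbT.
  rewrite [size _]/= exprS !(rmorphM (@emb D)) invfM mulrACA.
  exact: valuation_overringM.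
exists y; first by rewrite !inE eqxx orbT.
rewrite [size _]/= exprS !(rmorphM (@emb D)) invfM mulrACA divff // mul1r.
have -> : emb (y ^+ (size s).+1) / emb p =
    (emb y / emb x) ^+ (size s).+1 * (emb (x ^+ (size s).+1) / emb p).
  rewrite expr_div_n mulrA !(rmorphXn (@emb D)) divfK //.
  by rewrite expf_neq0.
by apply: valuation_overringM => //; apply: valuation_overringX.
Qed.

Definition valuative_element (D : idomainType) (a : D) : Prop :=
  exists2 V, valuation_overring V & valuative V a.

(** The value of [a] is at most that of the product, hence at most that of a power
of the factor [x] of largest value; so [a] divides this power. *)
Lemma valuative_dvd_prod (D : idomainType) (V : set {fraction D})
    (a : D) (s : seq D) :
  valuation_overring V -> valuative V a ->
  {in s, forall x, valuative_element x} -> s <> [::] ->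
  divides a (\prod_(x <- s) x) ->
  exists2 x, x \in s & divides a x \/ divides x a.
Proof.
case: s => // x0 s vV [a0 aP] sP _ [z az].
have s0 : {in x0 :: s, forall x, x != 0} by move=> x /sP[W _ []].
have p0 : \prod_(x <- x0 :: s) x != 0.
  by rewrite prodf_seq_neq0; apply/allP => x /s0.
have [x xs Vx] := valuation_overring_max_power vV s0; exists x => //.
have [W vW wx] := sP x xs; apply: (valuative_dvdX_comparable vW wx (n := size s)).
apply: aP; move: p0 Vx; rewrite az mulf_eq0 negb_or => /andP[_ z0] Vx.
have -> : emb (x ^+ (size s).+1) / emb a =
    emb (x ^+ (size s).+1) / emb (a * z) * emb z.
  by rewrite (rmorphM (@emb D)) invfM mulrA divfK ?emb_eq0.
by apply: valuation_overringM => //; apply: valuation_overring_emb.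
Qed.

(** Induction on the number of factors.  Some factor [x] is comparable with [a]:
if [a] divides [x], all of [a] goes to the side of [x]; otherwise [x] goes
there, and [a / x] divides the product of the remaining factors. *)
Lemma valuative_primal_prod (D : idomainType) (V : set {fraction D})
    (a : D) (s t : seq D) :
  valuation_overring V -> valuative V a ->
  {in s, forall x, valuative_element x} ->
  {in t, forall x, valuative_element x} ->
  divides a (\prod_(x <- s) x * \prod_(x <- t) x) ->
  splits a (\prod_(x <- s) x) (\prod_(x <- t) x).
Proof.
move=> vV; have [n] := ubnP (size (s ++ t)).
elim: n a s t => // n IHn a s t; rewrite size_cat => ltn va sP tP adiv.
(* The case where [a] is comparable with a factor of the first product; by
   symmetry of the statement it also covers the second product. *)
have hit s' t' : (size s' + size t' < n.+1)%N ->
    {in s', forall x, valuative_element x} ->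
    {in t', forall x, valuative_element x} ->
    divides a (\prod_(x <- s') x * \prod_(x <- t') x) ->
    (exists2 x, x \in s' & divides a x \/ divides x a) ->
    splits a (\prod_(y <- s') y) (\prod_(y <- t') y).
  move=> ltn' sP' tP' [z az] [x xs].
  have prodE : \prod_(y <- s') y = x * \prod_(y <- rem x s') y.
    by rewrite (perm_big _ (perm_to_rem xs)) big_cons.
  have x0 : x != 0 by have [W _ []] := sP' x xs.
  case=> -[c cE].
    exists a, 1; split; first by rewrite mulr1.
      by exists (c * \prod_(y <- rem x s') y); rewrite prodE cE mulrA.
    by exists (\prod_(y <- t') y); rewrite mul1r.
  have ltn2 : (size (rem x s' ++ t') < n)%N.
    by rewrite size_cat size_rem //; move: ltn'; case: (s') xs.
  have vc : valuative V c by apply: (valuative_dvd (y := x)); rewrite mulrC -cE.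
  have [||u [v [cuv [u' su] tv]]] := IHn c (rem x s') t' ltn2 vc _ tP'.
  - by move=> y /mem_rem; apply: sP'.
  - by exists z; apply: (mulfI x0); rewrite !mulrA -prodE az cE.
  exists (x * u), v; split=> //; first by rewrite cE cuv mulrA.
  by exists u'; rewrite prodE su mulrA.
have [/eqP|/eqP st0] := boolP (s ++ t == [::]).
  case: (s) (t) adiv => [|//] [|//]; rewrite !big_nil mulr1 => adiv _.
  exists a, 1; split; rewrite ?mulr1 //.
  by exists 1; rewrite mulr1.
have stP : {in s ++ t, forall x, valuative_element x}.
  by move=> x; rewrite mem_cat => /orP[/sP|/tP].
have stdiv : divides a (\prod_(x <- s ++ t) x) by rewrite big_cat.
have [x] := valuative_dvd_prod vV va stP st0 stdiv.
rewrite mem_cat => /orP[xs|xt] ax; first by apply: hit => //; exists x.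
have tdiv : divides a (\prod_(x <- t) x * \prod_(x <- s) x) by rewrite mulrC.
have [||u [v [auv tu sv]]] := hit t s _ tP sP tdiv.
- by rewrite addnC.
- by exists x.
by exists v, u; split=> //; rewrite mulrC.
Qed.

(** * Submodules of the quotient field *)

Lemma submodule_sum (D : idomainType) (A : set {fraction D}) n
    (x : 'I_n -> {fraction D}) :
  submodule A -> (forall i, A (x i)) -> A (\sum_(i < n) x i).
Proof. by case=> A0 AD _ Ax; apply: (big_ind A). Qed.

Lemma submoduleM (D : idomainType) (A : set {fraction D}) d x :
  submodule A -> base D d -> A x -> A (d * x).
Proof. by case=> _ _ AM [c _ <-]; apply: AM. Qed.

Lemma submodule_base (D : idomainType) : submodule (base D).
Proof.
split; first by exists 0 => //; rewrite rmorph0.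
  by move=> _ _ [a _ <-] [b _ <-]; exists (a + b) => //; rewrite rmorphD.
by move=> d x Dx; apply: baseM => //; apply: base_emb.
Qed.

Lemma submodule_scale (D : idomainType) (c : {fraction D}) A :
  submodule A -> submodule (scale c A).
Proof.
case=> A0 AD AM; split; first by exists 0 => //; rewrite mulr0.
  by move=> _ _ [x Ax <-] [y Ay <-]; exists (x + y); rewrite ?mulrDr //; apply: AD.
by move=> d _ [x Ax <-]; exists (emb d * x); rewrite 1?mulrCA //; apply: AM.
Qed.

Lemma submodule_idmul (D : idomainType) (A B : set {fraction D}) :
  submodule A -> submodule (idmul A B).
Proof.
case=> _ _ AM; split.
- by exists 0, (fun=> 0), (fun=> 0); split=> [[]|[]|] //; rewrite big_ord0.
- move=> _ _ [m [a [b [Aa Bb ->]]]] [n [a' [b' [Aa' Bb' ->]]]].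
  pose glue T (f : 'I_m -> T) g (i : 'I_(m + n)) :=
    match split i with inl j => f j | inr k => g k end.
  exists (m + n)%N, (glue _ a a'), (glue _ b b'); split.
  + by move=> i; rewrite /glue; case: (split i).
  + by move=> i; rewrite /glue; case: (split i).
  + rewrite big_split_ord /=; congr (_ + _); apply: eq_bigr => i _; rewrite /glue.
      by rewrite (unsplitK (inl i)).
    by rewrite (unsplitK (inr i)).
- move=> d _ [n [a [b [Aa Bb ->]]]].
  exists n, (fun i => emb d * a i), b; split=> // [i|]; first exact: AM.
  by rewrite mulr_sumr; apply: eq_bigr => i _; rewrite mulrA.
Qed.

Lemma idmul_mem (D : idomainType) (A B : set {fraction D}) a b :
  A a -> B b -> idmul A B (a * b).
Proof.
by move=> Aa Bb; exists 1%N, (fun=> a), (fun=> b); rewrite big_ord1.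
Qed.

Lemma idmul_sub (D : idomainType) (A B C : set {fraction D}) :
  submodule C -> (forall a b, A a -> B b -> C (a * b)) -> idmul A B `<=` C.
Proof.
move=> sC ABC _ [n [a [b [Aa Bb ->]]]].
by apply: submodule_sum => // i; apply: ABC.
Qed.

Lemma idmulC (D : idomainType) (A B : set {fraction D}) : idmul A B = idmul B A.
Proof.
by apply/seteqP; split=> _ [n [a [b [Aa Bb ->]]]]; exists n, b, a;
  split=> //; apply: eq_bigr => i _; rewrite mulrC.
Qed.

Lemma idmul_principal (D : idomainType) (c : {fraction D}) B :
  submodule B -> idmul (principal c) B = scale c B.
Proof.
move=> sB; apply/seteqP; split.
  apply: idmul_sub; first exact: submodule_scale.
  move=> _ b [d Dd <-] Bb; exists (d * b); last by rewrite mulrA.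
  exact: submoduleM.
move=> _ [b Bb <-]; apply: idmul_mem => //.
by exists 1; rewrite ?mulr1 //; apply: base1.
Qed.

Lemma submodule_overring (D : idomainType) (V : set {fraction D}) :
  overring V -> submodule V.
Proof.
move=> [[_ VB VM] DV]; have V0 : V 0.
  by apply: DV; exists 0 => //; rewrite rmorph0.
have VB' x y : V x -> V y -> V (x - y) by have := VB x y; rewrite !in_setE.
split=> // [x y Vx Vy|d x Vx].
  have -> : x + y = x - (0 - y) by rewrite sub0r opprK.
  by apply: (VB') => //; apply: (VB').
by have := VM (emb d) x; rewrite !in_setE; apply=> //; apply/DV/base_emb.
Qed.

Lemma dividesP (D : idomainType) (a d : D) :
  a != 0 -> divides a d <-> base D (emb d / emb a).
Proof.
move=> a0; split.
  case=> z ->; exists z => //.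
  by rewrite rmorphM mulrC mulKf // emb_eq0.
case=> z _ zE; exists z; apply: emb_inj.
by rewrite rmorphM /= zE mulrCA divff ?mulr1 ?emb_eq0.
Qed.

(** Inside [D], only the inclusion of [a V] in [a D] has content. *)
Lemma valuation_ideal_principal (D : idomainType) (a : D) :
  a != 0 -> valuation_ideal (principal (emb a)) <-> valuative_element a.
Proof.
move=> a0; have ea0 : emb a != 0 by rewrite emb_eq0.
have sub_base : principal (emb a) `<=` base D.
  by move=> _ [x Dx <-]; apply: baseM => //; apply: base_emb.
split=> [[_ [V vV VE]]|[V vV [_ aP]]].
  exists V => //; split=> // d Vd; apply/dividesP/principalP => //; rewrite -VE.
  rewrite idmul_principal; last by apply: submodule_overring; case: vV.
  split; last exact: base_emb.
  by exists (emb d / emb a) => //; rewrite mulrCA divff ?mulr1.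
split; first by split=> //; apply/submodule_scale/submodule_base.
exists V => //; rewrite idmul_principal; last by apply: submodule_overring; case: vV.
apply/seteqP; split.
  move=> _ [[v Vv <-] [d _ dE]]; rewrite -dE; apply/principalP/dividesP => //.
  by apply: aP; rewrite dE mulrC mulKf.
move=> x ax; split; last exact: sub_base.
by case: ax => d Dd <-; exists d => //; case: vV => -[_ DV] _; apply: DV.
Qed.

(** * Valuation factorization domains are pre-Schreier *)

(** Counting units as valuative removes the exception made for them in [VFD]. *)
Lemma VFD_factorization (D : idomainType) (a : D) :
  VFD D -> a != 0 ->
  exists n (b : 'I_n -> D),
    [/\ (0 < n)%N, forall i, valuative_element (b i) & a = \prod_(i < n) b i].
Proof.
move=> vfd a0; have [/unitrP[a' [a'a aa']]|aN] := boolP (a \is a GRing.unit).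
  exists 1%N, (fun=> a); rewrite big_ord1; split=> // _.
  (* A unit is valuative for the quotient field, the trivial valuation ring. *)
  exists setT; last by split=> // d _; exists (a' * d); rewrite mulrA aa' mul1r.
  split; last by move=> x _; left.
  by split=> //; split=> [|x y _ _|x y _ _]; rewrite in_setE.
have [n [b [bP aE]]] := vfd a a0 aN; exists n, b; split=> //.
  by case: n b bP aE => // b _ aE; rewrite aE big_ord0 unitr1 in aN.
by move=> i; have [b0 _ /valuation_ideal_principal] := bP i; apply.
Qed.

(** Split the first factor, cancel it, and split the second one along the two
cofactors. *)
Lemma primalM (D : idomainType) (p1 p2 : D) :
  p1 != 0 -> primal p1 -> primal p2 -> primal (p1 * p2).
Proof.
move=> p10 pr1 pr2 q r [z qrE].
have [|u1 [v1 [p1E [q' qE] [r' rE]]]] := pr1 q r.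
  by exists (p2 * z); rewrite qrE mulrA.
have [|u2 [v2 [p2E [q'' q'E] [r'' r'E]]]] := pr2 q' r'.
  by exists z; apply: (mulfI p10); rewrite [RHS]mulrA -qrE qE rE p1E mulrACA.
exists (u1 * u2), (v1 * v2); split; first by rewrite p1E p2E mulrACA.
  by exists q''; rewrite qE q'E mulrA.
by exists r''; rewrite rE r'E mulrA.
Qed.

Lemma VFD_valuative_primal (D : idomainType) (a : D) :
  VFD D -> valuative_element a -> primal a.
Proof.
move=> vfd [V vV va] q r adiv.
have [->|q0] := eqVneq q 0.
  exists a, 1; split; rewrite ?mulr1 //; first by exists 0; rewrite mulr0.
  by exists r; rewrite mul1r.
have [->|r0] := eqVneq r 0.
  exists 1, a; split; rewrite ?mul1r //; last by exists 0; rewrite mulr0.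
  by exists q; rewrite mul1r.
have [m [b [_ bP qE]]] := VFD_factorization vfd q0.
have [n [c [_ cP rE]]] := VFD_factorization vfd r0.
have prodE k (f : 'I_k -> D) : \prod_(i < k) f i = \prod_(x <- codom f) x.
  by rewrite /codom /image_mem big_map big_enum.
rewrite qE rE !prodE in adiv *.
by apply: (valuative_primal_prod vV va) => // x /codomP[i ->].
Qed.

Lemma VFD_primal (D : idomainType) (p : D) : VFD D -> p != 0 -> primal p.
Proof.
move=> vfd p0; have [n [b [_ bP pE]]] := VFD_factorization vfd p0.
rewrite pE; suff [] : \prod_(i < n) b i != 0 /\ primal (\prod_(i < n) b i) by [].
apply: (big_ind (fun x => x != 0 /\ primal x)).
- split=> [|q r _]; first exact: oner_neq0.
  exists 1, 1; rewrite mulr1; split=> //; first by exists q; rewrite mul1r.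
  by exists r; rewrite mul1r.
- by move=> x y [x0 px] [y0 py]; rewrite mulf_neq0 //; split=> //; apply: primalM.
- move=> i _; split; last exact: VFD_valuative_primal.
  by case: (bP i) => V _ [].
Qed.

(** * Riesz interpolation *)

(** The four products form a matrix over [D] with vanishing determinant.  Primality
of its first entry factors the matrix as a column [(u, t)] times a row
[(v, s)], and [a1 / u] separates the [a]'s from the [y]'s. *)
Lemma interpolation2 (D : idomainType) (a1 a2 y1 y2 : {fraction D}) :
  (forall p : D, p != 0 -> primal p) ->
  a1 != 0 -> y1 != 0 ->
  base D (a1 * y1) -> base D (a1 * y2) -> base D (a2 * y1) -> base D (a2 * y2) ->
  exists c, [/\ c != 0, base D (a1 / c), base D (a2 / c),
                base D (c * y1) & base D (c * y2)].
Proof.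
move=> pr a10 y10 [c11 _ E11] [c12 _ E12] [c21 _ E21] [c22 _ E22].
have c110 : c11 != 0 by rewrite -emb_eq0 E11 mulf_neq0.
have cE : c12 * c21 = c11 * c22.
  apply: emb_inj; rewrite !rmorphM /= E11 E12 E21 E22.
  by rewrite mulrACA [RHS]mulrACA [y2 * y1]mulrC.
have [|u [v [c11E [s sE] [t tE]]]] := pr c11 c110 c12 c21.
  by exists c22.
have [u0 v0] : u != 0 /\ v != 0.
  by move: c110; rewrite c11E mulf_eq0 negb_or => /andP.
have eu0 : emb u != 0 by rewrite emb_eq0.
have a2uE : a2 * emb u = a1 * emb t.
  apply: (mulIf y10); rewrite mulrAC -E21 tE [RHS]mulrAC -E11 c11E !rmorphM.
  by rewrite mulrC mulrA.
exists (a1 / emb u); split.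
- by rewrite mulf_neq0 ?invr_eq0.
- by rewrite invfM invrK mulVKf //; apply: base_emb.
- by exists t => //; rewrite invfM invrK [_^-1 * _]mulrC mulrA a2uE mulrC mulKf.
- by exists v => //; rewrite mulrAC -E11 c11E rmorphM mulrC mulKf.
- by exists s => //; rewrite mulrAC -E12 sE rmorphM mulrC mulKf.
Qed.

(** The interpolant found for the shorter list replaces that list: its inverse and
the new [y] are the two right-hand elements of [interpolation2]. *)
Lemma interpolation_left2 (D : idomainType) (a1 a2 y0 : {fraction D}) ys :
  (forall p : D, p != 0 -> primal p) ->
  a1 != 0 -> y0 != 0 ->
  {in y0 :: ys, forall y, base D (a1 * y) /\ base D (a2 * y)} ->
  exists c, [/\ c != 0, base D (a1 / c), base D (a2 / c)
              & {in y0 :: ys, forall y, base D (c * y)}].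
Proof.
move=> pr a10 y00; elim: ys => [|y ys IHys] ysP.
  have [Da1 Da2] := ysP y0 (mem_head _ _).
  exists y0^-1; rewrite invr_eq0 invrK; split=> // y; rewrite inE => /eqP->.
  by rewrite mulVf //; apply: base1.
have [|c [c0 Da1 Da2 cP]] := IHys.
  by move=> z; rewrite inE => zs; apply: ysP; rewrite !inE orbCA zs orbT.
have [Da1y Da2y] : base D (a1 * y) /\ base D (a2 * y).
  by apply: ysP; rewrite !inE eqxx orbT.
have [c' [c'0 Da1' Da2' Dc Dy]] := interpolation2 (a2 := a2) (y2 := y) pr a10
  (invr_neq0 c0) Da1 Da1y Da2 Da2y.
exists c'; split=> // z; rewrite !inE orbCA => /orP[/eqP->//|zs].
have -> : c' * z = c' / c * (c * z) by rewrite mulrA divfK.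
by apply: baseM => //; apply: cP; rewrite inE.
Qed.

(** With inverses of the [x]'s read as lower bounds and the [y]'s as upper bounds for
divisibility, [c^-1] lies between them.  Only the heads are assumed nonzero,
as a zero entry satisfies every condition. *)
Lemma interpolation (D : idomainType) (a0 y0 : {fraction D}) xs ys :
  (forall p : D, p != 0 -> primal p) ->
  a0 != 0 -> y0 != 0 ->
  {in a0 :: xs & y0 :: ys, forall x y, base D (x * y)} ->
  exists c, [/\ c != 0, {in a0 :: xs, forall x, base D (x / c)}
              & {in y0 :: ys, forall y, base D (c * y)}].
Proof.
move=> pr a00 y00; elim: xs => [|x xs IHxs] xsP.
  exists a0; split=> // [x|y ys0]; last by apply: xsP; rewrite ?mem_head.
  by rewrite inE => /eqP->; rewrite divff //; apply: base1.
have [|c [c0 cx cy]] := IHxs.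
  by move=> z y; rewrite inE => zs ys0; apply: xsP; rewrite // !inE orbCA zs orbT.
have [|c' [c'0 Dc Dx c'y]] := interpolation_left2 (a2 := x) pr c0 y00 (ys := ys).
  by move=> y ys0; split; [apply: cy | apply: xsP; rewrite // !inE eqxx orbT].
exists c'; split=> // z; rewrite !inE orbCA => /orP[/eqP->//|zs].
have -> : z / c' = z / c * (c / c') by rewrite mulrA divfK.
by apply: baseM => //; apply: cx; rewrite inE.
Qed.

(** * Fractional ideals *)

Lemma principal1 (D : idomainType) : principal 1 = base D.
Proof.
apply/seteqP; split=> [_ [x Dx <-]|x Dx]; first by rewrite mul1r.
by exists x; rewrite ?mul1r.
Qed.

Lemma principal_gen (D : idomainType) (c : {fraction D}) : principal c c.
Proof. by exists 1; rewrite ?mulr1 //; apply: base1. Qed.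

Lemma scaleM (D : idomainType) (c d : {fraction D}) A :
  scale c (scale d A) = scale (c * d) A.
Proof.
apply/seteqP; split=> [_ [_ [x Ax <-] <-]|_ [x Ax <-]].
  by exists x; rewrite ?mulrA.
by exists (d * x); [exists x | rewrite mulrA].
Qed.

Lemma idmul_principals (D : idomainType) (c d : {fraction D}) :
  idmul (principal c) (principal d) = principal (c * d).
Proof.
rewrite idmul_principal ?scaleM //.
exact/submodule_scale/submodule_base.
Qed.

Lemma frac_ideal_base (D : idomainType) : frac_ideal (base D).
Proof.
split; first exact: submodule_base.
  by exists 1 => [|x]; rewrite ?oner_neq0 // rmorph1 mul1r.
by exists 1; [apply: base1 | rewrite oner_neq0].
Qed.

Lemma frac_ideal_scale (D : idomainType) (c : {fraction D}) A :
  c != 0 -> frac_ideal A -> frac_ideal (scale c A).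
Proof.
move=> c0 [sA [d d0 dA] [x Ax x0]]; split; first exact: submodule_scale.
  have [e e0 ec] := denominator_exists c.
  exists (e * d); rewrite ?mulf_neq0 // => _ [y Ay <-].
  by rewrite rmorphM mulrACA; apply: baseM => //; apply: dA.
by exists (c * x); [exists x | rewrite mulf_neq0].
Qed.

Lemma frac_ideal_principal (D : idomainType) (c : {fraction D}) :
  c != 0 -> frac_ideal (principal c).
Proof. by move=> c0; apply: frac_ideal_scale => //; apply: frac_ideal_base. Qed.

Lemma frac_ideal_idmul (D : idomainType) (A B : set {fraction D}) :
  frac_ideal A -> frac_ideal B -> frac_ideal (idmul A B).
Proof.
move=> [sA [d d0 dA] [x Ax x0]] [sB [e e0 eB] [y By y0]]; split.
- exact: submodule_idmul.
- exists (d * e); rewrite ?mulf_neq0 // => _ [n [a [b [Aa Bb ->]]]].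
  rewrite mulr_sumr; apply: submodule_sum => [|i]; first exact: submodule_base.
  by rewrite rmorphM mulrACA; apply: baseM; [apply: dA | apply: eB].
- by exists (x * y); [apply: idmul_mem | rewrite mulf_neq0].
Qed.

Lemma frac_ideal_idinv (D : idomainType) (A : set {fraction D}) :
  frac_ideal A -> frac_ideal (idinv A).
Proof.
move=> [sA [d d0 dA] [x Ax x0]].
have [D0 DD _] := submodule_base D; split.
- split=> [a _|y z iy iz a Aa|e y iy a Aa]; rewrite ?mul0r //.
    by rewrite mulrDl; apply: DD; [apply: iy | apply: iz].
  by rewrite -mulrA; apply: baseM; [apply: base_emb | apply: iy].
- have [m _ mE] := dA x Ax; exists m.
    by rewrite -emb_eq0 mE mulf_neq0 ?emb_eq0.
  move=> y iy; rewrite mE -mulrA [x * y]mulrC.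
  by apply: baseM; [apply: base_emb | apply: iy].
- by exists (emb d); [exact: dA | rewrite emb_eq0].
Qed.

Lemma frac_ideal_integral (D : idomainType) (I : set {fraction D}) :
  ideal I -> I <> [set 0] -> frac_ideal I.
Proof.
move=> [sI ID] I0; split=> //.
  by exists 1 => [|x /ID]; rewrite ?oner_neq0 // rmorph1 mul1r.
apply: contrapT => nI; apply: I0; apply/seteqP; split=> [x Ix|_ ->].
  by apply: contrapT => /eqP x0; apply: nI; exists x.
by case: sI.
Qed.

(** * Star operations *)

(** A multiplication [z A <= B] survives the star operation on both sides; this is
the form in which the axioms on monotonicity and scaling are always combined
below. *)
Lemma star_colon (D : idomainType) (s : set {fraction D} -> set {fraction D})
    (A B : set {fraction D}) (z : {fraction D}) :
  star_operation s -> frac_ideal A -> frac_ideal B ->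
  (forall x, A x -> B (z * x)) -> forall x, s A x -> s B (z * x).
Proof.
move=> [sF _ sS sM _] fA fB zAB x sAx; have [z0|z0] := eqVneq z 0.
  by rewrite z0 mul0r; case: (sF B fB) => -[].
have : s (scale z A) `<=` s B.
  by apply: sS => //; [apply: frac_ideal_scale | move=> _ [y Ay <-]; apply: zAB].
by apply; rewrite sM //; exists x.
Qed.

Lemma star_principal (D : idomainType) (s : set {fraction D} -> set {fraction D})
    (c : {fraction D}) :
  star_operation s -> c != 0 -> s (principal c) = principal c.
Proof.
by move=> [_ _ _ sM sD] c0; rewrite sM ?sD //; apply: frac_ideal_base.
Qed.

Lemma star_integral (D : idomainType) (s : set {fraction D} -> set {fraction D})
    (A : set {fraction D}) :
  star_operation s -> frac_ideal A -> A `<=` base D -> s A `<=` base D.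
Proof.
by move=> [_ _ sS _ sD] fA AD; rewrite -sD; apply: sS => //; apply: frac_ideal_base.
Qed.

(** Applying [star_colon] to one factor and then to the other shows that the product
of the two generators lies in the closure of the product. *)
Lemma star_idmul_principal (D : idomainType)
    (s : set {fraction D} -> set {fraction D}) (A B : set {fraction D})
    (a b : {fraction D}) :
  star_operation s -> frac_ideal A -> frac_ideal B -> a != 0 -> b != 0 ->
  s A = principal a -> s B = principal b -> s (idmul A B) = principal (a * b).
Proof.
move=> ss fA fB a0 b0 sA sB; have [sF sE sS _ _] := ss.
have ab0 : a * b != 0 by rewrite mulf_neq0.
have fAB := frac_ideal_idmul fA fB.
have [A_sA _] := sE A fA; have [B_sB _] := sE B fB.
apply/seteqP; split.
  rewrite -(star_principal ss ab0); apply: sS => //.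
    exact: frac_ideal_principal.
  rewrite -idmul_principals; move=> _ [n [x [y [Ax By ->]]]].
  by exists n, x, y; rewrite -sA -sB; split=> // i; [apply: A_sA | apply: B_sB].
have [AB_s ssE] := sE _ fAB; have fsAB := sF _ fAB.
have sabP : s (idmul A B) (a * b).
  rewrite mulrC -ssE.
  apply: (star_colon ss fA fsAB); last by rewrite sA; apply: principal_gen.
  move=> x Ax; rewrite mulrC -ssE; apply: (star_colon ss fB fsAB).
    by move=> y By; apply: AB_s; apply: idmul_mem.
  by rewrite sB; apply: principal_gen.
by move=> _ [d Dd <-]; rewrite mulrC; apply: submoduleM => //; case: fsAB.
Qed.

(** The set [c^-1 B] is contained in the inverse of [s A], because
[b (s A) <= s (A B) = c D] for every [b] in [B]. *)
Lemma star_invertible_factor (D : idomainType)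
    (s : set {fraction D} -> set {fraction D}) (A B : set {fraction D})
    (c : {fraction D}) :
  star_operation s -> frac_ideal A -> frac_ideal B -> c != 0 ->
  s (idmul A B) = principal c -> star_inv_ideals s (s A).
Proof.
move=> ss fA fB c0 sABE; have [sF sE sS _ sD] := ss.
have [A_sA ssA] := sE A fA; have fsA := sF A fA.
have fAB := frac_ideal_idmul fA fB; have [AB_s _] := sE _ fAB.
have fP := frac_ideal_idmul fsA (frac_ideal_idinv fsA).
split=> //; apply/seteqP; split.
  apply: star_integral => //; apply: idmul_sub; first exact: submodule_base.
  by move=> a y sAa iy; rewrite mulrC; apply: iy.
have sP1 : s (idmul (s A) (idinv (s A))) 1.
  rewrite -(mulVf c0); apply: (star_colon ss fAB fP).
    move=> _ [n [a [b [Aa Bb ->]]]]; rewrite mulr_sumr.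
    apply: submodule_sum => [|i]; first by case: fP.
    rewrite mulrCA; apply: idmul_mem; first exact: A_sA.
    move=> x sAx; rewrite -mulrA mulrC; apply/principalP => //.
    rewrite -(star_principal ss c0); apply: (star_colon ss fA) => //.
      exact: frac_ideal_principal.
    by move=> y Ay; rewrite mulrC -sABE; apply: AB_s; apply: idmul_mem.
  by rewrite sABE; apply: principal_gen.
move=> x Dx; rewrite -[x]mulr1; apply: submoduleM => //.
by case: (sF _ fP).
Qed.

(** The coset of [I] contains [I] itself, and the coset of a principal ideal is the
set of all principal ideals. *)
Lemma Cl_trivialP (D : idomainType) (s : set {fraction D} -> set {fraction D}) :
  star_operation s ->
  Cl s = [set principals D] <-> star_inv_ideals s `<=` principals D.
Proof.
move=> ss; have one0 : (1 : {fraction D}) != 0 by rewrite oner_neq0.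
have cosetP (c : {fraction D}) : c != 0 ->
    op_coset (star_mul s) (principals D) (principal c) = principals D.
  move=> c0; apply/seteqP; split=> [_ [_ [d d0 <-] <-]|_ [d d0 <-]].
    rewrite /star_mul idmul_principals star_principal ?mulf_neq0 //.
    by exists (c * d) => //=; rewrite mulf_neq0.
  exists (principal (d / c)).
    by exists (d / c); rewrite //= mulf_neq0 ?invr_neq0.
  by rewrite /star_mul idmul_principals mulrCA divff // mulr1 star_principal.
split=> [clE I GI|GP].
  have <- : op_coset (star_mul s) (principals D) I = principals D.
    have : Cl s (op_coset (star_mul s) (principals D) I) by exists I.
    by rewrite clE.
  case: GI => -[sI _ _] sIE _.
  exists (principal 1); first by exists 1.
  rewrite /star_mul idmulC idmul_principal //.
  have -> : scale 1 I = I; last exact: sIE.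
  by rewrite /scale; apply/seteqP; split=> [_ [x Ix <-]|x Ix]; rewrite ?mul1r //;
     exists x; rewrite ?mul1r.
apply/seteqP; split=> [_ [I /GP[c c0 <-] <-]|_ ->]; first exact: cosetP.
exists (principal 1); last exact: cosetP.
rewrite -(star_principal ss one0).
apply: (star_invertible_factor (B := principal 1) (c := 1)) => //.
- exact: frac_ideal_principal.
- exact: frac_ideal_principal.
- by rewrite idmul_principals mulr1 star_principal.
Qed.

(** * Star-invertible ideals of a pre-Schreier domain *)

(** Collecting the factors that occur in finitely many elements of [A B]; the last
clause replaces membership in the ideal they generate. *)
Lemma idmul_finite_support (D : idomainType) (A B : set {fraction D}) n
    (g : 'I_n -> {fraction D}) :
  (forall i, idmul A B (g i)) ->
  exists xs ys : seq {fraction D},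
    [/\ {in xs, forall x, A x}, {in ys, forall y, B y} &
      forall M, submodule M -> {in xs & ys, forall x y, M (x * y)} ->
        forall i, M (g i)].
Proof.
elim: n g => [|n IHn] g gAB; first by exists [::], [::]; split=> // M _ _ [].
have [|xs [ys [xsA ysB xysP]]] := IHn (fun i => g (lift ord0 i)).
  by move=> i; apply: gAB.
have [m [a [b [Aa Bb gE]]]] := gAB ord0.
exists (codom a ++ xs), (codom b ++ ys); split.
- by move=> x; rewrite mem_cat => /orP[/codomP[i ->]|/xsA].
- by move=> y; rewrite mem_cat => /orP[/codomP[i ->]|/ysB].
move=> M sM MP i; case: (unliftP ord0 i) => [j ->|->].
  by apply: xysP => // x y xs_ ys_; apply: MP; rewrite mem_cat ?xs_ ?ys_ orbT.
rewrite gE; apply: submodule_sum => // k.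
by apply: MP; rewrite mem_cat codom_f.
Qed.

(** Take a finitely generated [C] in [I I^-1] whose closure contains [1], and
interpolate between the factors [x] in [I] and [y] in [I^-1] that occur in
[C].  As [c y] is in [D], [c C] is contained in [I], so [c] is in [I].
Conversely, for [z] in [I] the set [(z / c) C] is spanned by products
[(x / c) (z y)] of elements of [D], so [z / c] is in [D]. *)
Lemma star_invertible_principal (D : idomainType)
    (s : set {fraction D} -> set {fraction D}) :
  (forall p : D, p != 0 -> primal p) -> star_operation s -> finite_type s ->
  star_inv_ideals s `<=` principals D.
Proof.
move=> pr ss sfin I [fI sI sII']; have [sF sE sS sM sD] := ss.
have fI' := frac_ideal_idinv fI; have fII' := frac_ideal_idmul fI fI'.
have : s (idmul I (idinv I)) 1 by rewrite sII'; apply: base1.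
rewrite sfin // => -[C [[fC [n [g CE]]] CII'] sC1].
have Cg i : C (g i).
  rewrite CE; exists (fun j => (j == i)%:R) => //.
  rewrite (bigD1 i) //= eqxx rmorph1 mul1r.
  by rewrite big1 ?addr0 // => j /negbTE->; rewrite rmorph0 mul0r.
have gII' i : idmul I (idinv I) (g i) by apply: CII'; apply: Cg.
have [xs [ys [xsI ysI xysP]]] := idmul_finite_support gII'.
(* Nonzero heads for the two lists, as interpolation requires. *)
have [sMI _ [x0 Ix0 x00]] := fI; have [_ _ [y0 Iy0 y00]] := fI'.
have xyD : {in x0 :: xs & y0 :: ys, forall x y, base D (x * y)}.
  move=> x y; rewrite !inE => xP yP; rewrite mulrC.
  have iy : idinv I y by move: yP => /orP[/eqP->|/ysI].
  by apply: iy; move: xP => /orP[/eqP->|/xsI].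
have [c [c0 xc cy]] := interpolation pr x00 y00 xyD.
(* To multiply [C] into a submodule [M] it suffices to multiply the products
   [x y] into [M]. *)
have colonP z M : submodule M -> {in xs & ys, forall x y, M (z * (x * y))} ->
    forall w, C w -> M (z * w).
  move=> sMM zP w; rewrite CE => -[e _ <-]; rewrite mulr_sumr.
  apply: submodule_sum => // i; rewrite mulrCA; case: (sMM) => _ _; apply.
  have [z0|z0] := eqVneq z 0; first by rewrite z0 mul0r; case: sMM.
  have zM : {in xs & ys, forall x y, scale z^-1 M (x * y)}.
    by move=> x y xs_ ys_; exists (z * (x * y)); [apply: zP | rewrite mulKf].
  have [v Mv <-] := xysP _ (submodule_scale z^-1 sMM) zM i.
  by rewrite mulVKf.
exists c => //=; apply/seteqP; split.
  suff Ic : I c by move=> _ [d Dd <-]; rewrite mulrC; apply: submoduleM.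
  rewrite -sI -[c]mulr1; apply: (star_colon ss fC fI _ sC1).
  apply: colonP => // x y xs_ ys_; rewrite mulrCA mulrC.
  by apply: submoduleM; [| apply: cy; rewrite inE ys_ orbT | apply: xsI].
move=> x Ix; apply/principalP => //.
rewrite -sD -[x / c]mulr1; apply: (star_colon ss fC _ _ sC1).
  exact: frac_ideal_base.
apply: colonP => [|u y us_ ys_]; first exact: submodule_base.
rewrite mulrC [x / c]mulrC mulrACA.
by apply: baseM; [apply: xc; rewrite inE us_ orbT | apply: ysI].
Qed.

(** * Factorization of principal ideals *)

Lemma frac_ideal_idprod (D : idomainType) n (I : 'I_n -> set {fraction D}) :
  (forall i, frac_ideal (I i)) -> frac_ideal (idprod I).
Proof.
move=> fI; apply: (big_ind (@frac_ideal D)) => //; first exact: frac_ideal_base.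
exact: frac_ideal_idmul.
Qed.

Lemma idprod_principal (D : idomainType) n (c : 'I_n -> {fraction D}) :
  idprod (fun i => principal (c i)) = principal (\prod_(i < n) c i).
Proof.
rewrite /idprod; symmetry; apply: big_morph; last exact: principal1.
by move=> x y; rewrite idmul_principals.
Qed.

(** When a product has principal closure, each factor is invertible with inverse
coming from the product of the others; peel off the factors one by one. *)
Lemma star_idprod_factors_principal (D : idomainType)
    (s : set {fraction D} -> set {fraction D}) n (I : 'I_n -> set {fraction D})
    (c : {fraction D}) :
  star_operation s -> star_inv_ideals s `<=` principals D ->
  (forall i, frac_ideal (I i)) -> c != 0 -> s (idprod I) = principal c ->
  forall i, exists2 b, b != 0 & s (I i) = principal b.
Proof.
move=> ss trivial_s; elim: n I c => [|n IHn] I c fI c0 sIE i; first by case: i.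
have fQ : frac_ideal (idprod (fun j => I (lift ord0 j))).
  exact: frac_ideal_idprod.
rewrite /idprod big_ord_recl -/(idprod (fun j => I (lift ord0 j))) in sIE.
have [b b0 bE] := trivial_s _ (star_invertible_factor ss (fI ord0) fQ c0 sIE).
case: (unliftP ord0 i) => [j ->|->]; last by exists b.
rewrite idmulC in sIE.
have [d d0 dE] := trivial_s _ (star_invertible_factor ss fQ (fI ord0) c0 sIE).
exact: (IHn (fun j => I (lift ord0 j)) d).
Qed.

Lemma star_idprod_principal (D : idomainType)
    (s : set {fraction D} -> set {fraction D}) n (I : 'I_n -> set {fraction D})
    (b : 'I_n -> {fraction D}) :
  star_operation s -> (forall i, frac_ideal (I i)) -> (forall i, b i != 0) ->
  (forall i, s (I i) = principal (b i)) ->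
  s (idprod I) = principal (\prod_(i < n) b i).
Proof.
move=> ss fI b0 sIE.
suff [] : [/\ frac_ideal (idprod I), \prod_(i < n) b i != 0
    & s (idprod I) = principal (\prod_(i < n) b i)] by [].
apply: (big_ind2 (fun A x => [/\ frac_ideal A, x != 0 & s A = principal x])) => //.
- split; [exact: frac_ideal_base | exact: oner_neq0 |].
  by rewrite principal1; case: ss.
- move=> A x B y [fA x0 sA] [fB y0 sB]; split; first exact: frac_ideal_idmul.
    by rewrite mulf_neq0.
  exact: star_idmul_principal.
Qed.

(** If [d] is in [b V], then [(d / b) I] is contained in [I V `&` D = I], hence in
[b D]; closing up, [(d / b) b] is in [b D]. *)
Lemma valuation_ideal_star_principal (D : idomainType)
    (s : set {fraction D} -> set {fraction D}) (I : set {fraction D}) (b : D) :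
  star_operation s -> valuation_ideal I -> frac_ideal I -> b != 0 ->
  s I = principal (emb b) -> valuative_element b.
Proof.
move=> ss [_ [V vV VE]] fI b0 sIE; have eb0 : emb b != 0 by rewrite emb_eq0.
have [_ sE _ _ _] := ss; have [I_sI _] := sE I fI.
exists V => //; split=> // d Vd; apply/dividesP/principalP => //.
rewrite -(star_principal ss eb0) -[emb d](divfK eb0).
apply: (star_colon ss fI (frac_ideal_principal eb0)).
  move=> x Ix; have sIx := I_sI x Ix; have := I_sI (emb d / emb b * x).
  rewrite sIE in sIx *; apply; rewrite -VE; split.
    by rewrite mulrC; apply: idmul_mem.
  rewrite -mulrA [_^-1 * x]mulrC; apply: baseM; first exact: base_emb.
  exact/principalP.
by rewrite sIE; apply: principal_gen.
Qed.

Lemma principal_inj (D : idomainType) (a b : D) :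
  a != 0 -> b != 0 -> principal (emb a) = principal (emb b) ->
  exists2 e, e \is a GRing.unit & a = e * b.
Proof.
move=> a0 b0 abE; have [ea0 eb0] : emb a != 0 /\ emb b != 0 by rewrite !emb_eq0.
have [e aE] : divides b a.
  by apply/dividesP/principalP => //; rewrite -abE; apply: principal_gen.
have [f bE] : divides a b.
  by apply/dividesP/principalP => //; rewrite abE; apply: principal_gen.
exists e; last by rewrite mulrC.
apply/unitrPr; exists f; apply: (mulfI b0).
by rewrite mulr1 mulrA -aE -bE.
Qed.

Lemma valuative_element_mul_unit (D : idomainType) (e a : D) :
  e \is a GRing.unit -> valuative_element a -> valuative_element (e * a).
Proof.
move=> ue [V vV va]; exists V => //; apply: (valuative_dvd (y := e^-1)).
by rewrite mulrC mulKr.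
Qed.

(** Units among the factors are collected with [e] and absorbed into one of the
nonunit factors, which exists since the product is not a unit. *)
Lemma valuative_factorization (D : idomainType) n (b : 'I_n -> D) (e : D) :
  e \is a GRing.unit -> (forall i, valuative_element (b i)) ->
  e * \prod_(i < n) b i \isn't a GRing.unit ->
  exists m (c : 'I_m -> D), (forall i, valuation_element (c i)) /\
    e * \prod_(i < n) b i = \prod_(i < m) c i.
Proof.
move=> ue bP aN.
pose u := e * \prod_(i < n | b i \is a GRing.unit) b i.
have uu : u \is a GRing.unit by rewrite unitrM ue; apply: rpred_prod.
pose t := [seq b i | i <- enum 'I_n & b i \isn't a GRing.unit].
have aE : e * \prod_(i < n) b i = u * \prod_(x <- t) x.
  rewrite (bigID (fun i => b i \is a GRing.unit)) mulrA.
  by rewrite big_map big_filter big_enum_cond.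
have tP : {in t, forall x, valuative_element x /\ x \isn't a GRing.unit}.
  by move=> _ /mapP[i + ->]; rewrite mem_filter => /andP[? _].
rewrite aE in aN *; case: t tP aN {aE} => [|x t] tP aN.
  by rewrite big_nil mulr1 uu in aN.
have tP' : {in u * x :: t, forall y, valuation_element y}.
  have val_elt y :
      valuative_element y -> y \isn't a GRing.unit -> valuation_element y.
    move=> yv yN; have y0 : y != 0 by case: yv => V _ [].
    by split=> //; apply/valuation_ideal_principal.
  move=> y; rewrite inE => /orP[/eqP->|yt]; last first.
    by have [] := tP y; [rewrite inE yt orbT | apply: val_elt].
  have [xv xN] := tP x (mem_head _ _).
  by apply: val_elt; [apply: valuative_element_mul_unit | rewrite unitrM uu].
exists (size (u * x :: t)), (tnth (in_tuple (u * x :: t))); split.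
  by move=> i; apply: tP'; apply: mem_tnth.
transitivity (\prod_(y <- u * x :: t) y); last by rewrite big_tnth.
by rewrite !big_cons mulrA.
Qed.

Lemma VFD_star_VIFD (D : idomainType) (s : set {fraction D} -> set {fraction D}) :
  star_operation s -> VFD D -> star_VIFD s.
Proof.
move=> ss vfd a a0; have [n [b [n0 bP aE]]] := VFD_factorization vfd a0.
have b0 i : b i != 0 by case: (bP i) => V _ [].
exists n, (fun i => principal (emb (b i))); split=> // [i|].
  split; first exact/valuation_ideal_principal.
  move=> /seteqP[/(_ _ (principal_gen (emb (b i)))) /eqP].
  by rewrite emb_eq0 (negbTE (b0 i)).
by rewrite idprod_principal -rmorph_prod -aE star_principal // emb_eq0.
Qed.

Lemma star_VIFD_VFD (D : idomainType)
    (s1 s2 : set {fraction D} -> set {fraction D}) :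
  star_operation s1 -> star_operation s2 -> star_le s1 s2 ->
  star_VIFD s1 -> star_inv_ideals s2 `<=` principals D -> VFD D.
Proof.
move=> ss1 ss2 s12 vifd trivial_s2 a a0 aN.
have ea0 : emb a != 0 by rewrite emb_eq0.
have [n [I [_ IP aI]]] := vifd a a0.
have fI i : frac_ideal (I i).
  by have [[idI _] I0] := IP i; apply: frac_ideal_integral.
have fP := frac_ideal_idprod fI.
have s2P : s2 (idprod I) = principal (emb a).
  apply/seteqP; split; last by rewrite aI; apply: s12.
  have [_ sE1 _ _ _] := ss1; have [_ _ sS2 _ _] := ss2.
  rewrite -(star_principal ss2 ea0); apply: sS2 => //.
    exact: frac_ideal_principal.
  by rewrite aI; case: (sE1 _ fP).
have /choice[b bP] i : exists b : D, b != 0 /\ s2 (I i) = principal (emb b).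
  have [c c0 sIE] := star_idprod_factors_principal ss2 trivial_s2 fI ea0 s2P i.
  have [b _ bE] : base D c.
    have [[[_ ID] _] _] := IP i.
    apply: (star_integral ss2 (fI i) ID); rewrite sIE.
    exact: principal_gen.
  by exists b; rewrite -emb_eq0 bE.
have b0 i : b i != 0 by case: (bP i).
have aE : principal (emb a) = principal (emb (\prod_(i < n) b i)).
  rewrite -s2P rmorph_prod; apply: star_idprod_principal => // i.
    by rewrite emb_eq0.
  by case: (bP i).
have prod0 : \prod_(i < n) b i != 0 by apply/prodf_neq0 => i _.
have [e ue aE'] := principal_inj a0 prod0 aE.
have bv i : valuative_element (b i).
  have [bi0 sIE] := bP i; have [vI _] := IP i.
  exact: (valuation_ideal_star_principal ss2 vI).
by rewrite aE' in aN *; apply: valuative_factorization.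
Qed.

Lemma star_operation_d (D : idomainType) : star_operation (@d_operation D).
Proof. by split=> // A fA; split. Qed.

(** The span of [x] and a fixed nonzero [x0] of [A] is a nonzero finitely generated
ideal for every [x] in [A], including [x = 0]. *)
Lemma finite_type_d (D : idomainType) : finite_type (@d_operation D).
Proof.
move=> A [sA [d d0 dA] [x0 Ax0 x00]]; apply/seteqP; split; last first.
  by move=> x [C [_ CA] Cx]; apply: CA.
move=> x Ax; pose g (i : 'I_2) := if i == ord0 then x else x0.
have gA : dspan g `<=` A.
  move=> _ [c _ <-]; apply: submodule_sum => // i.
  by apply: submoduleM => //; [apply: base_emb | rewrite /g; case: ifP].
have gx (y z : D) : dspan g (emb y * x + emb z * x0).
  exists (fun i => if i == ord0 then y else z) => //.
  by rewrite big_ord_recl big_ord1 /g.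
exists (dspan g); last by have := gx 1 0; rewrite rmorph1 rmorph0 mul1r mul0r addr0.
split=> //; split; last by exists 2, g.
split.
- split.
  + by have := gx 0 0; rewrite rmorph0 !mul0r addr0.
  + move=> _ _ [c _ <-] [c' _ <-]; exists (fun i => c i + c' i) => //.
    by rewrite -big_split; apply: eq_bigr => i _; rewrite rmorphD mulrDl.
  + move=> e _ [c _ <-]; exists (fun i => e * c i) => //.
    by rewrite mulr_sumr; apply: eq_bigr => i _; rewrite rmorphM mulrA.
- by exists d => // y /gA; apply: dA.
- by exists x0 => //; have := gx 0 1; rewrite rmorph1 rmorph0 mul1r mul0r add0r.
Qed.

Lemma Pic_Cl_d (D : idomainType) : Pic D = Cl (@d_operation D).
Proof.
rewrite /Pic /Cl; congr (coset_space _ _ _).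
by apply/seteqP; split=> [I []|I []].
Qed.

Theorem corollary3p6 (D : idomainType) :
  (forall s1 s2 : set {fraction D} -> set {fraction D},
     star_operation s1 -> finite_type s1 ->
     star_operation s2 -> finite_type s2 ->
     star_le s1 s2 ->
     (VFD D <-> star_VIFD s1 /\ Cl s2 = [set principals D]))
  /\ (VFD D <-> VIFD D /\ Pic D = [set principals D]).
Proof.
have main s1 s2 : star_operation s1 -> star_operation s2 -> finite_type s2 ->
    star_le s1 s2 -> (VFD D <-> star_VIFD s1 /\ Cl s2 = [set principals D]).
  move=> ss1 ss2 fs2 s12; split=> [vfd|[vifd /(Cl_trivialP ss2)]].
    split; first exact: VFD_star_VIFD.
    apply/(Cl_trivialP ss2)/star_invertible_principal => // p.
    exact: VFD_primal.
  exact: (star_VIFD_VFD ss1 ss2 s12 vifd).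
split; first by move=> s1 s2 ss1 _; apply: main.
rewrite Pic_Cl_d; apply: (main _ _ (@star_operation_d D) (@star_operation_d D)) => //.
  exact: finite_type_d.
by move=> A _; apply: subset_refl.
Qed.
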